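(* There is an absolute constant $C$ such that for every graph $G$ with maximum degree $\Delta\geq 2$, $$\pi_{\mathrm{ch}}(G)\leq \Delta^2 + 2^{4/3} \Delta^{5/3} + C\, \Delta^{4/3}.$$ (That is, $\pi_{\mathrm{ch}}(G)\leq \Delta^2 + 2^{4/3} \Delta^{5/3} + O( \Delta^{4/3})$.)
   Context: All graphs are finite, simple and undirected. A path is a sequence of pairwise distinct vertices, consecutive ones adjacent. Given a colouring $\phi$, a sequence $(v_1,\dots,v_{2t})$ is repetitively coloured if $\phi(v_i)=\phi(v_{t+i})$ for all $i\in\{1,\dots,t\}$; a colouring is nonrepetitive if no path is repetitively coloured. A $k$-list-assignment $L$ assigns to each vertex $v$ a set $L(v)$ with $|L(v)|\ge k$; an $L$-colouring is a colouring $\phi$ with $\phi(v)\in L(v)$. $\pi_{\mathrm{ch}}(G)$ is the minimum $k$ such that $G$ has a nonrepetitive $L$-colouring for every $k$-list-assignment $L$ of $G$. *)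

(* Defs.v *)
From mathcomp Require Import all_boot.
From mathcomp Require Import boolp classical_sets functions cardinality.

Set Implicit Arguments.
Unset Strict Implicit.
Unset Printing Implicit Defensive.

Local Open Scope classical_set_scope.
Local Open Scope card_scope.

Record sgraph := SGraph {
  vertex :> finType;
  adj : rel vertex;
  adj_sym : symmetric adj;
  adj_irrefl : irreflexive adj }.

Definition degree (G : sgraph) (v : G) : nat := #|[set w : G | adj v w]%SET|.

Definition max_degree (G : sgraph) : nat := \max_(v : G) degree v.

Definition is_path (G : sgraph) (p : seq G) : bool := uniq p && sorted (@adj G) p.

(* [t] must be positive, otherwise the empty sequence would be repetitive. The
   default vertex [x0] is irrelevant, as all indices are within bounds. *)
Definition repetitively_coloured (V C : Type) (phi : V -> C) (p : seq V) : Prop :=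
  exists t : nat, [/\ 0 < t, size p = 2 * t &
    forall (x0 : V) (i : nat), i < t ->
      phi (nth x0 p i) = phi (nth x0 p (t + i))].

Definition nonrepetitive (G : sgraph) (C : Type) (phi : G -> C) : Prop :=
  forall p : seq G, is_path p -> ~ repetitively_coloured phi p.

(* Lists are arbitrary, possibly infinite, sets of colours of an arbitrary type;
   [`I_k] is the set of the naturals smaller than [k]. *)
Definition list_assignment (G : sgraph) (C : Type) (k : nat) (L : G -> set C) :
    Prop :=
  forall v, `I_k #<= L v.

Definition list_colouring (G : sgraph) (C : Type) (L : G -> set C)
    (phi : G -> C) : Prop :=
  forall v, L v (phi v).

Definition nonrepetitively_choosable (G : sgraph) (k : nat) : Prop :=
  forall (C : Type) (L : G -> set C), list_assignment k L ->
    exists phi : G -> C, list_colouring L phi /\ nonrepetitive phi.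

Lemma injective_nonrepetitive (G : sgraph) (C : Type) (phi : G -> C) :
  injective phi -> nonrepetitive phi.
Proof.
move=> phiI [|x p] /andP[p_uniq _] [t [t_gt0 p_size /(_ _ 0 t_gt0)]].
  by move: t_gt0 p_size; case: t.
move=> /(_ x)/phiI/eqP.
rewrite nth_uniq // ?addn0 ?p_size ?muln_gt0 //; last first.
  by rewrite mul2n -addnn -[X in X < _]addn0 ltn_add2l.
by rewrite eq_sym eqn0Ngt t_gt0.
Qed.

Lemma card_nonrepetitively_choosable (G : sgraph) :
  nonrepetitively_choosable G #|G|.
Proof.
move=> C L L_large; set n := #|G|.
have f_ex v : exists f : 'I_n -> C, injective f /\ forall i, L v (f i).
  have /card_leP[g] := L_large v.
  have inIn (i : 'I_n) : nat_of_ord i \in `I_n by apply/mem_set => /=.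
  exists (fun i => val (g (SigSub (inIn i)))); split=> [i j /val_inj|i].
    move=> /(@inj _ _ _ g); rewrite !inE => /(_ I I).
    by move=> /(congr1 val)/=; exact: val_inj.
  exact: set_valP.
have {f_ex}[f f_spec] := choice f_ex.
have [phi [phiL phiI]] : exists phi : G -> C,
    list_colouring L phi /\ {in enum G &, injective phi}.
  elim: (enum G) (enum_uniq G) => [_|v s IHs /= /andP[v_s /[dup] s_uniq]].
    have n_gt0 (v : G) : 0 < n by apply/card_gt0P; exists v.
    by exists (fun v => f v (Ordinal (n_gt0 v))); split=> // v; case: (f_spec v).
  move=> /IHs[phi [phiL phiI]].
  have [fvI fvL] := f_spec v.
  have [i fvi] : exists i, forall w, w \in s -> phi w <> f v i.
    apply: contrapT => /forallNP fvs.
    have {fvs} /choice[g g_spec] i : exists w, w \in s /\ phi w = f v i.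
      apply: contrapT => /forallNP H; apply: (fvs i) => w ws E.
      exact: (H w).
    have gI : injective g.
      by move=> i j gij; apply: fvI; rewrite -(g_spec i).2 -(g_spec j).2 gij.
    have n_le : n <= size s.
      rewrite -[n]card_ord -(card_codom gI) -(card_uniqP s_uniq).
      by apply/subset_leq_card/fintype.subsetP => _ /codomP[i ->]; case: (g_spec i).
    have : size (v :: s) <= n.
      have vs_uniq : uniq (v :: s) by rewrite /= v_s.
      by rewrite -(card_uniqP vs_uniq) max_card.
    by rewrite ltnNge n_le.
  exists (fun w => if w == v then f v i else phi w); split=> [w|w1 w2].
    by case: eqP => [->|_].
  rewrite !inE; case: eqVneq => [->|_] /=; case: eqVneq => [->|_] //=.
  - by move=> _ /fvi/nesym.
  - by move=> /fvi.
  - exact: phiI.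
exists phi; split=> //; apply: injective_nonrepetitive => v w.
by apply: phiI; rewrite mem_enum.
Qed.

Lemma nonrepetitively_choosable_ex (G : sgraph) :
  exists k, `[< nonrepetitively_choosable G k >].
Proof. by exists #|G|; apply/asboolP; exact: card_nonrepetitively_choosable. Qed.

Definition pi_ch (G : sgraph) : nat := ex_minn (nonrepetitively_choosable_ex G).

(* Main.v *)
Require Import Defs.
From mathcomp Require Import boolp classical_sets functions cardinality.
From mathcomp Require Import all_boot all_order all_algebra.
From mathcomp Require Import reals exp.
From mathcomp Require Import ring lra zify.

(**
Rosenfeld's counting argument. Let N(S) be the number of nonrepetitive
L-colourings of the subgraph induced by S. With lists of size k, one shows
N(S) >= b N(S - v) for all v in S by induction on |S|. Indeed k N(S - v)
colourings extend a nonrepetitive colouring of S - v to v; if such an extension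
is repetitive on a path p with 2t vertices, then p contains v, and uncolouring
the half Q of p that contains v loses no information, so for a given p there are
at most N(S - Q) <= b^(1-t) N(S - v) of them. At most 2t D^(2t-1) paths with 2t
vertices contain v, where D is the maximum degree, so it suffices that
  k >= b + sum_(t >= 1) 2t D^(2t-1) b^(1-t) = b + 2D / (1 - D^2/b)^2.
Taking b = D^2 + 2^(1/3) D^(5/3) gives the theorem.
*)

Import Order.TTheory GRing.Theory Num.Theory.
Local Open Scope ring_scope.

(** * Counting walks in graphs of bounded degree *)

Lemma walks_from_count (G : sgraph) (D : nat) (v : G) (m : nat) :
  (forall w : G, (degree w <= D)%N) ->
  exists2 s : seq (seq G), (size s <= D ^ m)%N &
    forall p, path (@adj G) v p -> size p = m -> p \in s.
Proof.
move=> degD; elim: m v => [|m IHm] v.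
  by exists [:: [::]] => // -[].
pose walks w := projT1 (cid2 (IHm w)).
have walksP w p : path (@adj G) w p -> size p = m -> p \in walks w.
  by rewrite /walks; case: cid2 => s ? /=; apply.
have size_walks w : (size (walks w) <= D ^ m)%N.
  by rewrite /walks; case: cid2.
exists [seq w :: p | w <- enum [set w | adj v w], p <- walks w].
  rewrite size_allpairs_dep sumnE big_map expnS.
  apply: leq_trans (leq_mul (degD v) (leqnn _)).
  rewrite /degree cardE -sum1_size big_distrl /=.
  by apply: leq_sum => w _; rewrite mul1n.
case=> [//|w p] /= /andP[vw wp] [sp].
apply/allpairsPdep; exists w, p; split=> //; last exact: walksP.
by rewrite mem_enum inE.
Qed.

(** Cutting at [v] leaves two walks that start at [v], of lengths [i] and [m - i], the first one
    read backwards. Each of the [m.+1] positions of [v] thus contributes at most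
    [D ^ i * D ^ (m - i)] walks. *)
Lemma walks_through_count (G : sgraph) (D : nat) (v : G) (m : nat) :
  (forall w : G, (degree w <= D)%N) ->
  exists2 s : seq (seq G), (size s <= m.+1 * D ^ m)%N &
    forall p, sorted (@adj G) p -> size p = m.+1 -> v \in p -> p \in s.
Proof.
move=> degD.
pose walks i := projT1 (cid2 (@walks_from_count G D v i degD)).
have walksP i p : path (@adj G) v p -> size p = i -> p \in walks i.
  by rewrite /walks; case: cid2 => s ? /=; apply.
have size_walks i : (size (walks i) <= D ^ i)%N.
  by rewrite /walks; case: cid2.
pose through i := [seq rev a ++ v :: b | a <- walks i, b <- walks (m - i)%N].
exists (flatten [seq through i | i <- iota 0 m.+1]).
  have -> : (m.+1 * D ^ m = \sum_(i <- iota 0 m.+1) D ^ m)%N.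
    by rewrite big_const_seq count_predT size_iota iter_addn_0 mulnC.
  rewrite size_flatten sumnE !big_map.
  rewrite [X in (X <= _)%N]big_seq [X in (_ <= X)%N]big_seq.
  apply: leq_sum => i; rewrite mem_iota add0n ltnS => /andP[_ im].
  rewrite size_allpairs -[in X in (_ <= X)%N](subnKC im) expnD.
  exact: leq_mul.
move=> p p_walk sp /splitPr p_v; case: p_v p_walk sp => a b.
rewrite size_cat [size (_ :: _)]/= addnS => ab [sab].
apply/flatten_mapP; exists (size a); first by rewrite mem_iota /=; lia.
apply/allpairsP; exists (rev a, b); rewrite /= revK; split=> //; last first.
  apply: walksP; last by lia.
  by case: a ab {sab} => [//|x a] /=; rewrite cat_path /= => /and3P[].
apply: walksP; last by rewrite size_rev.
have : sorted (@adj G) (rcons a v).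
  by move: ab; rewrite -cat_rcons; move/cat_sorted2 => [].
rewrite -rev_sorted rev_rcons /=.
by apply: sub_path => x y; rewrite adj_sym.
Qed.

(** * Repetitive paths and their halves *)

Lemma repetitively_coloured_eq_in (V : eqType) (C : Type) (phi psi : V -> C)
    (p : seq V) : {in p, phi =1 psi} ->
  repetitively_coloured phi p -> repetitively_coloured psi p.
Proof.
move=> eq_p [t [t_gt0 sp rep]]; exists t; split=> // x0 i it.
by rewrite -!eq_p ?mem_nth ?sp //; [apply: rep | lia | lia].
Qed.

(** [Q] is the half containing [v], and [w'] is the vertex at the same place as [w] in the other
    half. Both are chosen before the colouring, so that two colourings repetitive on [p] can later
    be compared through the same [Q] and [w']. *)
Lemma repetitive_half (V : finType) (p : seq V) (t : nat) (v : V) :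
  uniq p -> size p = (2 * t)%N -> v \in p ->
  exists Q : {set V}, [/\ v \in Q, #|Q| = t, {subset Q <= p} &
    forall w, w \in Q -> exists2 w', (w' \in p) && (w' \notin Q) &
      forall (C : Type) (phi : V -> C), repetitively_coloured phi p ->
        phi w = phi w'].
Proof.
move=> p_uniq sp vp.
have rep_nth (C : Type) (phi : V -> C) i : repetitively_coloured phi p ->
    (i < t)%N -> phi (nth v p i) = phi (nth v p (t + i)).
  move=> [t' [_ sp' rep]] it; have tt' : t = t' by lia.
  by subst t'; apply: rep.
have size_take_p : size (take t p) = t by rewrite size_takel // sp; lia.
have size_drop_p : size (drop t p) = t by rewrite size_drop sp; lia.
move: (p_uniq); rewrite -{1}(cat_take_drop t p) cat_uniq.
move=> /and3P[take_uniq /hasPn td drop_uniq].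
have [v_take|v_drop] := boolP (v \in take t p).
  exists [set x in take t p]; split.
  - by rewrite inE.
  - by rewrite cardsE (card_uniqP take_uniq).
  - by move=> x; rewrite inE => /mem_take.
  move=> w; rewrite inE => /(nthP v)[i]; rewrite size_take_p => it <-.
  exists (nth v p (t + i)) => [|C phi rep]; last first.
    by rewrite nth_take // -rep_nth.
  rewrite inE mem_nth /=; last by rewrite sp; lia.
  by apply: td; rewrite -nth_drop mem_nth ?size_drop_p.
exists [set x in drop t p]; split.
- move: vp v_drop; rewrite inE -{1}(cat_take_drop t p) mem_cat.
  by move=> /orP[->|].
- by rewrite cardsE (card_uniqP drop_uniq).
- by move=> x; rewrite inE => /mem_drop.
move=> w; rewrite inE => /(nthP v)[i]; rewrite size_drop_p => it <-.
exists (nth v p i) => [|C phi rep]; last first.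
  by rewrite nth_drop -rep_nth.
rewrite inE mem_nth /=; last by rewrite sp; lia.
by apply/negP => /td /=; rewrite -(nth_take v it) mem_nth // size_take_p.
Qed.

Lemma leq_card_bigcup (T : finType) (I : Type) (r : seq I) (F : I -> {set T}) :
  (#|\bigcup_(i <- r) F i| <= \sum_(i <- r) #|F i|)%N.
Proof.
elim: r => [|i r IHr]; first by rewrite !big_nil cards0.
rewrite !big_cons; apply: leq_trans (leq_card_setU _ _) _.
by rewrite leq_add2l.
Qed.

(** * Counting nonrepetitive colourings of induced subgraphs *)

Section CountingColourings.
Context {R : realType} {G : sgraph} {C : Type} {k D : nat}.
Variable (f : G -> 'I_k.+1 -> C).
Hypothesis f_inj : forall v, injective (f v).
Hypothesis deg_le : forall v : G, (degree v <= D)%N.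

(** A colouring is stored as indices into [k.+1] distinct colours picked from each list by [f]. This
    makes colourings a finite type, while repetitions are judged on the actual colours. *)
Definition colour_of (c : {ffun G -> 'I_k.+1}) (v : G) : C := f v (c v).

Definition nonrepetitive_on (S : {set G}) (c : {ffun G -> 'I_k.+1}) : bool :=
  `[< forall p : seq G, is_path p -> {subset p <= S} ->
        ~ repetitively_coloured (colour_of c) p >].

(* Partial colourings of [S] are encoded by the value [ord0] outside [S]. *)
Definition partial_on (S : {set G}) (c : {ffun G -> 'I_k.+1}) : bool :=
  [forall v, (v \notin S) ==> (c v == ord0)].

(** The cardinality of this set is N(S). *)
Definition colourings (S : {set G}) : {set {ffun G -> 'I_k.+1}} :=
  [set c | partial_on S c & nonrepetitive_on S c].

Definition restrict (S : {set G}) (c : {ffun G -> 'I_k.+1}) :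
    {ffun G -> 'I_k.+1} := [ffun v => if v \in S then c v else ord0].

Lemma partial_onP (S : {set G}) (c : {ffun G -> 'I_k.+1}) :
  reflect (forall v, v \notin S -> c v = ord0) (partial_on S c).
Proof. by apply: (iffP forall_inP) => H v /H/eqP. Qed.

Lemma nonrepetitive_on_eq_in (S T : {set G}) (c d : {ffun G -> 'I_k.+1}) :
  S \subset T ->
  {in S, c =1 d} -> nonrepetitive_on T c -> nonrepetitive_on S d.
Proof.
move=> /subsetP ST cd /asboolP nr; apply/asboolP => p p_path pS.
have pT x : x \in p -> x \in T by move/pS/ST.
move=> rep; apply: (nr p p_path pT).
by apply: repetitively_coloured_eq_in rep => x /pS xS; rewrite /colour_of cd.
Qed.

Lemma restrict_colourings (S T : {set G}) c : S \subset T ->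
  nonrepetitive_on T c -> restrict S c \in colourings S.
Proof.
move=> ST nr; rewrite inE; apply/andP; split.
  by apply/partial_onP => v vS; rewrite ffunE (negPf vS).
by apply: nonrepetitive_on_eq_in nr => // v vS; rewrite ffunE vS.
Qed.

Lemma colourings_set0 : (0 < #|colourings set0|)%N.
Proof.
apply/card_gt0P; exists [ffun=> ord0]; rewrite inE; apply/andP; split.
  by apply/partial_onP => v _; rewrite ffunE.
apply/asboolP => -[|x p] _ p0 [t [t_gt0 sp _]]; first by move: sp => /=; lia.
by have := p0 x (mem_head _ _); rewrite inE.
Qed.

(** Such a colouring of [S] can be repetitive only on paths through [v]. *)
Definition extensions (S : {set G}) (v : G) : {set {ffun G -> 'I_k.+1}} :=
  [set c | partial_on S c & nonrepetitive_on (S :\ v) c].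

Lemma card_extensions (S : {set G}) v : v \in S ->
  (k.+1 * #|colourings (S :\ v)| <= #|extensions S v|)%N.
Proof.
move=> vS.
pose ext (ca : {ffun G -> 'I_k.+1} * 'I_k.+1) : {ffun G -> 'I_k.+1} :=
  [ffun w => if w == v then ca.2 else ca.1 w].
have ext_inj : {in setX (colourings (S :\ v)) [set: 'I_k.+1] &,
    injective ext}.
  move=> [c a] [d b]; rewrite !inE /= => /andP[/andP[/partial_onP c0 _] _].
  move=> /andP[/andP[/partial_onP d0 _] _] /ffunP cd; congr pair.
    apply/ffunP => w; have := cd w; rewrite !ffunE; case: eqVneq => [->|//].
    by rewrite c0 ?d0 // !inE eqxx.
  by have := cd v; rewrite !ffunE eqxx.
rewrite mulnC -[X in (_ * X)%N]card_ord -cardsT -cardsX.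
rewrite -(card_in_imset ext_inj).
apply/subset_leq_card/subsetP => e /imsetP[[c a]].
rewrite !inE /= => /andP[/andP[/partial_onP c0 nr] _] ->; apply/andP; split.
  apply/partial_onP => w wS; rewrite ffunE; case: eqVneq => [wv|_] /=.
    by rewrite wv vS in wS.
  by rewrite c0 // !inE negb_and wS orbT.
apply: nonrepetitive_on_eq_in nr => // w; rewrite !inE => /andP[/negPf wv _].
by rewrite ffunE wv.
Qed.

(** The index is shifted: halves have [t.+1] vertices, so that [t] is the number of vertices other
    than [v] in the uncoloured half. *)
Definition repetitive_extensions (S : {set G}) (v : G) (t : nat) (p : seq G) :
    {set {ffun G -> 'I_k.+1}} :=
  [set c in extensions S v | `[< [/\ size p = (2 * t.+1)%N, is_path p,
    {subset p <= S}, v \in p & repetitively_coloured (colour_of c) p] >]].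

Lemma extensions_cover (S : {set G}) v (W : nat -> seq (seq G)) :
  (forall t p, sorted (@adj G) p -> size p = (2 * t.+1)%N -> v \in p ->
    p \in W t) ->
  (#|extensions S v| <= #|colourings S| +
    \sum_(t < #|G|) \sum_(p <- W t) #|repetitive_extensions S v t p|)%N.
Proof.
move=> WP.
pose bad := \bigcup_(t < #|G|) \bigcup_(p <- W t) repetitive_extensions S v t p.
have le_bad : (#|bad| <=
    \sum_(t < #|G|) \sum_(p <- W t) #|repetitive_extensions S v t p|)%N.
  apply: leq_trans (leq_card_bigcup _ _ _ _) _.
  by apply: leq_sum => t _; apply: leq_card_bigcup.
apply: leq_trans (leq_add (leqnn _) le_bad).
apply: leq_trans (leq_card_setU _ _); apply/subset_leq_card/subsetP => c cE.
rewrite inE; have [//|/= c_rep] := boolP (c \in colourings S).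
move: (cE); rewrite inE => /andP[c0 c_nr].
move: c_rep; rewrite inE c0 /= => /asboolPn/existsNP[p] /not_implyP[p_path].
move=> /not_implyP[pS /contrapT c_rep].
have [[|t] [// _ sp _]] := c_rep.
move: (p_path) => /andP[p_uniq p_walk].
(* A path avoiding [v] would lie in [S :\ v], where [c] is nonrepetitive. *)
have vp : v \in p.
  apply/negPn/negP => vp; move/asboolP: c_nr => /(_ p p_path); apply => // x xp.
  by rewrite !inE pS // andbT; apply: contraNneq vp => <-.
have tG : (t < #|G|)%N.
  have := max_card [in p]; rewrite (card_uniqP p_uniq) sp; lia.
apply/bigcupP; exists (Ordinal tG) => //=.
rewrite (big_rem p) ?WP //= inE; apply/orP; left.
by rewrite inE cE /=; apply/asboolP.
Qed.

(** Uncolouring the half [Q] is injective on these colourings, since the other half dictates the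
    colours on [Q]. The results are counted by N(S - Q), to which the assumed inequality applies. *)
Lemma card_repetitive_extensions (S : {set G}) v t p (b : R) : 0 < b ->
  (forall Q : {set G}, Q \subset S :\ v ->
    #|colourings ((S :\ v) :\: Q)|%:R * b ^+ #|Q|
      <= #|colourings (S :\ v)|%:R) ->
  #|repetitive_extensions S v t p|%:R * b ^+ t <= #|colourings (S :\ v)|%:R.
Proof.
move=> b_gt0 IH.
(* A member of the set is used only to learn that [p] is a path in [S] through [v] with [2 * t.+1]
   vertices. *)
have [->|[c0]] := set_0Vmem (repetitive_extensions S v t p).
  by rewrite cards0 mul0r ler0n.
rewrite inE => /andP[_ /asboolP[sp /andP[p_uniq _] pS vp _]].
have [Q [vQ cardQ Qp QP]] := @repetitive_half G p t.+1 v p_uniq sp vp.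
have restr_inj : {in repetitive_extensions S v t p &,
    injective (restrict (S :\: Q))}.
  move=> c d; rewrite !inE.
  move=> /andP[/andP[/partial_onP cS _] /asboolP[_ _ _ _ c_rep]].
  move=> /andP[/andP[/partial_onP dS _] /asboolP[_ _ _ _ d_rep]] /ffunP cd.
  have cdQ w : w \in S -> w \notin Q -> c w = d w.
    by move=> wS wQ; have := cd w; rewrite !ffunE !inE wS wQ.
  apply/ffunP => w; have [wS|wS] := boolP (w \in S); last by rewrite cS ?dS.
  have [wQ|] := boolP (w \in Q); last exact: cdQ.
  have [w' /andP[/pS w'S w'Q] w'P] := QP w wQ.
  apply: (@f_inj w); have := w'P _ _ c_rep; have := w'P _ _ d_rep.
  by rewrite /colour_of (cdQ w') // => -> ->.
(* As [v] lies in [Q], removing [Q] from [S] amounts to removing [Q :\ v], of size [t], from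
   [S :\ v]; hence the exponent [t] of [b]. *)
have le_card : (#|repetitive_extensions S v t p| <=
    #|colourings ((S :\ v) :\: (Q :\ v))|)%N.
  have -> : (S :\ v) :\: (Q :\ v) = S :\: Q.
    by apply/setP => x; rewrite !inE; case: eqVneq => [->|_]; rewrite ?vQ.
  rewrite -(card_in_imset restr_inj); apply/subset_leq_card/subsetP.
  move=> _ /imsetP[c /setIdP[/setIdP[_ c_nr] _] ->].
  apply: (@restrict_colourings _ (S :\ v)) => //; apply/subsetP => x.
  by rewrite !inE => /andP[xQ ->]; rewrite andbT; apply: contraNneq xQ => ->.
have cardQv : #|Q :\ v| = t.
  by move: cardQ; rewrite (cardsD1 v) vQ add1n => -[].
apply: le_trans (IH (Q :\ v) _); last first.
  by apply/setSD/subsetP => x /Qp/pS.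
by rewrite cardQv ler_wpM2r ?ler_nat // exprn_ge0 // ltW.
Qed.

(** Of the at least [k.+1 * N] extensions to [v], the repetitive ones number at most [N] times the
    sum over [t], which leaves at least [b * N]. *)
Lemma colourings_setD1 (S : {set G}) v (b : R) : 0 < b -> v \in S ->
  b + \sum_(t < #|G|) (2 * t.+1)%:R * D%:R ^+ (2 * t).+1 * b ^- t <= k.+1%:R ->
  (forall Q : {set G}, Q \subset S :\ v ->
    #|colourings ((S :\ v) :\: Q)|%:R * b ^+ #|Q|
      <= #|colourings (S :\ v)|%:R) ->
  #|colourings (S :\ v)|%:R * b <= #|colourings S|%:R.
Proof.
move=> b_gt0 vS b_le IH; set N := #|colourings (S :\ v)|%:R : R.
pose W t := projT1 (cid2 (@walks_through_count G D v (2 * t).+1 deg_le)).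
have WP t p : sorted (@adj G) p -> size p = (2 * t.+1)%N -> v \in p ->
    p \in W t.
  rewrite /W; case: cid2 => s _ /= sP p_walk sp vp.
  by apply: sP => //; rewrite sp; lia.
have size_W t : (size (W t) <= (2 * t.+1) * D ^ (2 * t).+1)%N.
  by rewrite /W; case: cid2 => s + _ /=; rewrite mulnS.
have bad_le t : (\sum_(p <- W t) #|repetitive_extensions S v t p|)%:R <=
    (2 * t.+1)%:R * D%:R ^+ (2 * t).+1 * b ^- t * N.
  apply: (@le_trans _ _ ((size (W t))%:R * (b ^- t * N))).
    rewrite natr_sum -sum1_size natr_sum mulr_suml; apply: ler_sum => p _.
    rewrite mul1r mulrC ler_pdivlMr ?exprn_gt0 //.
    exact: card_repetitive_extensions.
  rewrite -[leRHS]mulrA ler_wpM2r //.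
    by rewrite mulr_ge0 ?ler0n ?invr_ge0 ?exprn_ge0 ?(ltW b_gt0).
  by rewrite -natrX -natrM ler_nat.
have : (k.+1)%:R * N <= #|colourings S|%:R +
    \sum_(t < #|G|) (2 * t.+1)%:R * D%:R ^+ (2 * t).+1 * b ^- t * N.
  apply: (@le_trans _ _ #|extensions S v|%:R).
    by rewrite -natrM ler_nat card_extensions.
  apply: le_trans (_ : _ <= (#|colourings S| + \sum_(t < #|G|)
    \sum_(p <- W t) #|repetitive_extensions S v t p|)%:R) _.
    by rewrite ler_nat extensions_cover.
  by rewrite natrD lerD2l natr_sum; apply: ler_sum => t _.
have := ler_wpM2r (ler0n R _ : 0 <= N) b_le.
rewrite -mulr_suml mulrDl => le1 /(le_trans le1).
by rewrite addrC [leRHS]addrC lerD2l mulrC.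
Qed.

(** Each vertex removed costs a factor [b]. The induction on the size of [S] treats all [Q] at once,
    because the one-vertex step at [S] uses the inequality for every subset of [S :\ v]. *)
Lemma colourings_setD (S Q : {set G}) (b : R) : 0 < b ->
  b + \sum_(t < #|G|) (2 * t.+1)%:R * D%:R ^+ (2 * t).+1 * b ^- t <= k.+1%:R ->
  Q \subset S ->
  #|colourings (S :\: Q)|%:R * b ^+ #|Q| <= #|colourings S|%:R.
Proof.
move=> b_gt0 b_le; have [n] := ubnP #|S|; elim: n S Q => // n IHn S Q Sn QS.
have [->|[v vQ]] := set_0Vmem Q; first by rewrite cards0 expr0 mulr1 setD0.
have vS := subsetP QS v vQ.
have IH (P : {set G}) : P \subset S :\ v ->
    #|colourings ((S :\ v) :\: P)|%:R * b ^+ #|P|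
      <= #|colourings (S :\ v)|%:R :> R.
  by apply: IHn; move: Sn; rewrite (cardsD1 v S) vS add1n ltnS.
apply: le_trans (@colourings_setD1 S v b b_gt0 vS b_le IH).
have -> : S :\: Q = (S :\ v) :\: (Q :\ v).
  by apply/setP => x; rewrite !inE; case: eqVneq => [->|_]; rewrite ?vQ.
rewrite (cardsD1 v Q) vQ add1n exprSr mulrA ler_wpM2r ?(ltW b_gt0) //.
by apply: IH; apply: setSD.
Qed.

Lemma nonrepetitive_colouring_ex (b : R) : 0 < b ->
  b + \sum_(t < #|G|) (2 * t.+1)%:R * D%:R ^+ (2 * t).+1 * b ^- t <= k.+1%:R ->
  exists c : {ffun G -> 'I_k.+1}, nonrepetitive (colour_of c).
Proof.
move=> b_gt0 b_le.
(* Removing all vertices compares N(G) with N of the empty set, which is positive. *)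
have := @colourings_setD [set: G] [set: G] b b_gt0 b_le (subxx _).
rewrite setDv => le_card.
have : (0 < #|colourings [set: G]|)%N.
  rewrite -(ltr_nat R); apply: lt_le_trans le_card.
  by rewrite mulr_gt0 ?exprn_gt0 // ltr0n colourings_set0.
move=> /card_gt0P[c]; rewrite inE => /andP[_ /asboolP c_nr].
by exists c => p p_path; apply: c_nr => // x _; rewrite inE.
Qed.

End CountingColourings.

(** * From the counting condition to a sufficient list size *)

Lemma arithmetico_geometric_le (F : realFieldType) (r : F) (n : nat) :
  0 <= r < 1 -> \sum_(t < n) t.+1%:R * r ^+ t <= (1 - r) ^- 2.
Proof.
move=> /andP[r_ge0 r_lt1].
(* Both terms subtracted from 1 in this closed form are nonnegative. *)
have closed : (\sum_(t < n) t.+1%:R * r ^+ t) * (1 - r) ^+ 2 =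
    1 - r ^+ n - n%:R * r ^+ n * (1 - r).
  elim: n => [|n IHn]; first by rewrite big_ord0 !mul0r expr0 subrr subr0.
  by rewrite big_ord_recr /= mulrDl IHn [r ^+ n.+1]exprS -natr1; ring.
have r1_gt0 : 0 < 1 - r by rewrite subr_gt0.
rewrite -[leRHS]mul1r ler_pdivlMr ?exprn_gt0 // closed.
have rn : 0 <= r ^+ n by rewrite exprn_ge0.
have := mulr_ge0 (mulr_ge0 (ler0n F n) rn) (ltW r1_gt0).
by move: (n%:R * r ^+ n * (1 - r)) => y; lra.
Qed.

Lemma nonrepetitively_choosable_bound (R : realType) (G : sgraph) (D k : nat)
    (b : R) : (forall v : G, (degree v <= D)%N) -> D%:R ^+ 2 < b ->
  b + 2 * D%:R * (1 - D%:R ^+ 2 / b) ^- 2 <= k%:R ->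
  nonrepetitively_choosable G k.
Proof.
move=> deg_le D_b b_le C L L_large.
have b_gt0 : 0 < b by apply: le_lt_trans D_b; rewrite exprn_ge0.
case: k b_le L_large => [|k] b_le L_large.
  suff : b <= 0 by move: b_gt0; lra.
  apply: le_trans b_le; rewrite lerDl mulr_ge0 ?mulr_ge0 ?ler0n //.
  by rewrite invr_ge0 sqr_ge0.
have f_ex v : exists f : 'I_k.+1 -> C, injective f /\ forall i, L v (f i).
  have /card_leP[g] := L_large v.
  have inIk (i : 'I_k.+1) :
      nat_of_ord i \in (`I_k.+1)%classic by apply/mem_set => /=.
  exists (fun i => val (g (SigSub (inIk i)))); split=> [i j /val_inj|i].
    move=> /(@inj _ _ _ g); rewrite !classical_sets.inE => /(_ I I).
    by move=> /(congr1 val)/=; exact: val_inj.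
  exact: set_valP.
have {f_ex}[f f_spec] := choice f_ex.
have f_inj v : injective (f v) by have [] := f_spec v.
have [|c c_nr] := @nonrepetitive_colouring_ex R G C k D f f_inj deg_le b b_gt0.
  apply: le_trans b_le; rewrite lerD2l.
  have r_itv : 0 <= D%:R ^+ 2 / b < 1.
    by rewrite divr_ge0 ?exprn_ge0 ?(ltW b_gt0) //= ltr_pdivrMr ?mul1r.
  have := arithmetico_geometric_le R _ #|G| r_itv.
  move=> /(ler_wpM2l (mulr_ge0 (ler0n R 2) (ler0n R D))).
  (* With r = D^2/b, each summand 2(t+1) D^(2t+1) b^(-t) equals 2D (t+1) r^t. *)
  apply: le_trans; rewrite mulr_sumr le_eqVlt; apply/orP; left; apply/eqP.
  apply: eq_bigr => t _.
  by rewrite natrM exprS exprM expr_div_n; ring.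
by exists (colour_of f c); split=> // v; have [_] := f_spec v; apply.
Qed.

(** * Optimising the bound *)

Lemma powR_divn3 (R : realType) (y : R) (n : nat) : 0 <= y ->
  y `^ (n%:R / 3) = (y `^ 3^-1) ^+ n.
Proof. by move=> y_ge0; rewrite mulrC powRrM powR_mulrn ?powR_ge0. Qed.

Theorem theorem31 (R : realType) :
  exists C : R, forall G : sgraph, (2 <= max_degree G)%N ->
    (pi_ch G)%:R <=
      (max_degree G)%:R ^+ 2
      + 2 `^ (4 / 3) * (max_degree G)%:R `^ (5 / 3)
      + C * (max_degree G)%:R `^ (4 / 3).
Proof.
pose a : R := 2 `^ 3^-1.
have a3 : a ^+ 3 = 2.
  by rewrite -powR_divn3 ?ler0n // divff ?pnatr_eq0 // powRr1.
have a_gt0 : 0 < a by rewrite powR_gt0.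
(* [2 * a ^+ 2] is the coefficient of [x ^+ 4] in [z] below. Of the 3, 2 absorbs the term
   [2 * x ^+ 3] and 1 absorbs the rounding up of [z] to an integer. *)
exists (2 * a ^+ 2 + 3) => G D_ge2; set D := max_degree G in D_ge2 *.
pose x : R := D%:R `^ 3^-1.
have x3 : x ^+ 3 = D%:R.
  by rewrite -powR_divn3 ?ler0n // divff ?pnatr_eq0 // powRr1 ?ler0n.
(* From here on everything is polynomial in the cube roots [a] of 2 and [x] of [D]; in particular
   2^(4/3) becomes [a ^+ 4], which is [2 * a]. *)
rewrite !powR_divn3 ?ler0n // -/a -/x -x3.
have x_ge1 : 1 <= x.
  by rewrite -(@expr_ge1 _ 3) ?powR_ge0 // x3 ler1n; apply: ltnW.
have x_gt0 : 0 < x by apply: lt_le_trans x_ge1.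
have deg_le (v : G) : (degree v <= D)%N by apply: leq_bigmax.
(* The choice of [b] balances the two terms of order [x ^+ 5]. *)
pose b : R := x ^+ 6 + a * x ^+ 5.
(* This is b + 2D / (1 - D^2/b)^2 for the chosen [b]: here 1 - D^2/b = a/(x + a) and 2D = a^3
   x^3. *)
pose z : R := b + a * x ^+ 3 * (x + a) ^+ 2.
have z_ge0 : 0 <= z.
  by apply/ltW; rewrite !addr_gt0 ?mulr_gt0 ?exprn_gt0 ?addr_gt0.
have /andP[_ z_lt] := truncn_itv z_ge0.
have choosable : nonrepetitively_choosable G (Num.truncn z).+1.
  apply: (@nonrepetitively_choosable_bound R G D _ b deg_le).
    by rewrite -x3 -exprM /b ltrDl mulr_gt0 ?exprn_gt0.
  apply: le_trans (ltW z_lt); rewrite /z lerD2l le_eqVlt.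
  apply/orP; left; apply/eqP; rewrite -x3.
  (* With 2 written as [a ^+ 3], the identity holds for rational functions in [a] and [x], so
     [field] can prove it. *)
  have -> : 2 * x ^+ 3 = a ^+ 3 * x ^+ 3 by rewrite a3.
  rewrite /b; field.
  by rewrite addrAC subrr add0r !lt0r_neq0 ?addr_gt0 ?mulr_gt0 ?exprn_gt0.
have pi_le : (pi_ch G <= (Num.truncn z).+1)%N.
  by rewrite /pi_ch; case: ex_minnP => m _; apply; apply/asboolP.
apply: le_trans (_ : _ <= z + 1) _.
  apply: le_trans (_ : (Num.truncn z).+1%:R <= _); first by rewrite ler_nat.
  by rewrite -natr1 lerD2r; have /andP[] := truncn_itv z_ge0.
have x4_ge1 : 1 <= x ^+ 4 by rewrite expr_ge1 // ltW.
have x34 : x ^+ 3 <= x ^+ 4.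
  by rewrite [leRHS]exprS ler_peMl // exprn_ge0 // ltW.
have -> : z = x ^+ 6 + 2 * a * x ^+ 5 + 2 * a ^+ 2 * x ^+ 4 + a ^+ 3 * x ^+ 3.
  by rewrite /z /b; ring.
rewrite [a ^+ 4]exprSr !a3 -exprM; lra.
Qed.
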